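(* Let $n\ge 3$ be an integer and let $G$ be a simple graph on $n$ vertices with \[ \lambda(G)\ge \lambda\bigl(K_{\lceil n/2\rceil,\lfloor n/2\rfloor}^{+}\bigr). \] Then $t(G)\ge \lfloor n/2\rfloor$, with equality if and only if $G$ is isomorphic to $K_{\lceil n/2\rceil,\lfloor n/2\rfloor}^{+}$.
   Context: All graphs are finite and simple. For a graph $G$, $\lambda(G)$ denotes the spectral radius of $G$, i.e. the maximum modulus of the eigenvalues of its adjacency matrix $A(G)$ (where $A(G)_{ij}=1$ if vertices $v_i,v_j$ are adjacent and $0$ otherwise). $t(G)$ denotes the number of triangles (copies of $K_3$ as subgraphs) in $G$. $K_{s,t}$ is the complete bipartite graph with parts of sizes $s$ and $t$. $K_{\lceil n/2\rceil,\lfloor n/2\rfloor}^{+}$ denotes the $n$-vertex graph obtained from the complete bipartite graph $K_{\lceil n/2\rceil,\lfloor n/2\rfloor}$ by adding exactly one edge joining two vertices of the part of size $\lceil n/2\rceil$ (the larger part; either part if $n$ is even). *)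

(* Defs.v *)
From HB Require Import structures.
From mathcomp Require Import all_boot all_order all_algebra.
From mathcomp Require Import boolp classical_sets reals complex.

Set Implicit Arguments.
Unset Strict Implicit.
Unset Printing Implicit Defensive.

Import Order.TTheory GRing.Theory Num.Theory.
Local Open Scope ring_scope.
Local Open Scope complex_scope.

Record sgraph (V : finType) := SGraph {
  adj :> rel V;
  adj_sym : symmetric adj;
  adj_irr : irreflexive adj }.

Definition isomorphic (V W : finType) (G : sgraph V) (H : sgraph W) : Prop :=
  exists2 f : V -> W, bijective f & forall x y, H (f x) (f y) = G x y.

Definition triangles (V : finType) (G : sgraph V) : nat :=
  #|[set A : {set V} |
      (#|A| == 3)%N && [forall x in A, forall y in A, (x != y) ==> G x y]]|.

Definition adjmx (K : nzRingType) (V : finType) (G : sgraph V) : 'M[K]_#|V| :=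
  \matrix_(i, j) (G (enum_val i) (enum_val j))%:R.

(* The eigenvalues form a finite set, nonempty when the matrix is, so this
   supremum is a maximum (see spectral_radius_attained and
   spectral_radius_ge). *)
Definition spectral_radius (R : realType) (n : nat) (A : 'M[R[i]]_n) : R :=
  sup [set Normc.normc z | z in [set z : R[i] | eigenvalue A z]].

Definition lambda (R : realType) (V : finType) (G : sgraph V) : R :=
  spectral_radius (adjmx R[i] G).

(* The vertices i < uphalf n = ceil(n/2) form the larger part; the added edge
   joins 0 and 1, which both lie in that part once n >= 3. *)
Definition Kplus_rel (n : nat) : rel 'I_n := fun i j =>
  ((i < uphalf n) != (j < uphalf n))%N || [&& i != j, (i < 2)%N & (j < 2)%N].

Lemma Kplus_sym n : symmetric (@Kplus_rel n).
Proof.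
by move=> i j; rewrite /Kplus_rel eq_sym (eq_sym i j) [(i < 2)%N && _]andbC.
Qed.

Lemma Kplus_irr n : irreflexive (@Kplus_rel n).
Proof. by move=> i; rewrite /Kplus_rel !eqxx. Qed.

Definition Kplus (n : nat) : sgraph 'I_n :=
  SGraph (@Kplus_sym n) (@Kplus_irr n).

Section SpectralRadiusIsMax.
Variables (R : realType) (n : nat) (A : 'M[R[i]]_n).

Let moduli := [set Normc.normc z | z in [set z : R[i] | eigenvalue A z]]%classic.

Let moduli_seq : exists s : seq R,
  forall x, moduli x <-> x \in s.
Proof.
have [r rE] := closed_field_poly_normal (char_poly A).
exists [seq Normc.normc z | z <- r] => x.
have memr z : eigenvalue A z = (z \in r).
  rewrite eigenvalue_root_char rE (monicP (char_poly_monic A)) scale1r.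
  by rewrite root_prod_XsubC.
split=> [[z /= + <-]|/mapP[z zr ->]]; first by rewrite memr => /map_f; apply.
by exists z; rewrite //= memr.
Qed.

Lemma spectral_radius_ge z : eigenvalue A z ->
  Normc.normc z <= spectral_radius A.
Proof.
move=> Az; have [s sP] := moduli_seq.
apply: ub_le_sup; last by exists z.
exists (\sum_(x <- s) `|x|) => x /sP xs.
rewrite (le_trans (ler_norm x))// (big_rem x xs)/= lerDl.
by apply: sumr_ge0.
Qed.

Lemma spectral_radius_attained : (0 < n)%N ->
  exists2 z, eigenvalue A z & Normc.normc z = spectral_radius A.
Proof.
move=> n_gt0.
have [z0 Az0] : exists z, eigenvalue A z.
  have /closed_rootP[z rz] : size (char_poly A) != 1%N.
    by rewrite size_char_poly eqSS -lt0n.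
  by exists z; rewrite eigenvalue_root_char.
have [s sP] := moduli_seq.
have ms0 : moduli (Normc.normc z0) by exists z0.
have : forall (t : seq R) x0, x0 \in t ->
    exists2 m, m \in t & forall x, x \in t -> x <= m.
  elim=> // a t IH x0 _; case: t IH => [_|b t IH].
    by exists a; rewrite ?mem_head// => x; rewrite inE => /eqP->.
  have [m mt mP] := IH b (mem_head _ _).
  have [am|ma] := leP a m.
    exists m; first by rewrite inE mt orbT.
    by move=> x; rewrite inE => /orP[/eqP->//|/mP].
  exists a; first by rewrite mem_head.
  move=> x; rewrite inE => /orP[/eqP->//|/mP /le_trans]; apply; exact: ltW.
move=> /(_ s (Normc.normc z0)) [|m /sP[z Az zm] mP]; first exact/sP.
exists z => //; apply/le_anti; rewrite spectral_radius_ge//=.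
apply: ge_sup; first by exists (Normc.normc z0).
by move=> x /sP /mP; rewrite zm.
Qed.

End SpectralRadiusIsMax.

(* Main.v *)
(* Let k = n./2, p = uphalf n, M = k p, and let m be the number of edges and t
   the number of triangles of G.

   If m > M, then t >= k already holds (Rademacher).  An edge uv in no triangle
   satisfies d(u) + d(v) <= n.  In case of equality N(u) and N(v) partition the
   vertices, every edge inside a part makes a triangle with u or v, and there is
   such an edge because m > M; the other triangles are counted by induction on
   G - u - v.  Otherwise G - u - v has at least two edges above its bipartite
   bound, and the Moon-Moser inequality n T + n^2 E >= 2 E^2 (E = 2m, T = 6t)
   gives it enough triangles.  If every edge is in a triangle, then 3 t >= m,
   which is enough unless n <= 4.  Equality forces exactly one edge inside the
   parts of a complete balanced bipartite graph.

   If m <= M, let w be the vector of moduli of an eigenvector for an eigenvalue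
   of largest modulus, normalised; its Rayleigh quotient mu is at least
   lambda(G).  With s = sqrt M and q = 1 / p one has lambda(Kplus n) >= s + q.
   Deflating the adjacency matrix A by w gives B with
   tr B^2 = 2m - mu^2 <= (s - q)^2, and |tr B^3| <= (tr B^2)^(3/2) leads to
   6 t = tr A^3 >= (s + q)^3 - (s - q)^3 > 6 s^2 q = 6 k. *)
Require Import Defs.
From mathcomp Require Import all_boot all_order all_algebra.
From mathcomp Require Import reals complex.
From mathcomp Require Import zify ring lra.

(* Moon-Moser on 2k (then 2k + 1) vertices, with 2 + r/2 edges above the bipartite
   bound, refutes t <= k + 1. *)
Lemma surplus_even k r :
 2 * (2 * (k * k) + 4 + r) ^ 2 <=
  (k + k) * (6 * k.+1) + (k + k) ^ 2 * (2 * (k * k) + 4 + r) ->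
  False.
Proof.
rewrite !expnS !expn0 !muln1.
(* After cancellation the left side exceeds the right one by 4k^2 - 12k + 32 plus nonnegative terms
   in [r]; 6k <= k^2 + 9 makes this positive. *)
have h : 2 * (k * 3) <= k ^ 2 + 3 ^ 2 := nat_Cauchy k 3.
rewrite expnS expn1 in h.
have h1 := leq0n (k * (k * r)).
have h2 := leq0n (r * r).
lia.
Qed.

Lemma surplus_odd k r :
 2 * (2 * (k * k.+1) + 4 + r) ^ 2 <=
  (k + k.+1) * (6 * k.+1) + (k + k.+1) ^ 2 * (2 * (k * k.+1) + 4 + r) ->
  False.
Proof.
rewrite !expnS !expn0 !muln1.
have h : 2 * (k * 1) <= k ^ 2 + 1 ^ 2 := nat_Cauchy k 1.
rewrite expnS expn1 in h.
have h1 := leq0n (k * (k * r)).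
have h2 := leq0n (r * r).
have h3 := leq0n (k * r).
lia.
Qed.

Lemma half_uphalf n : n = n./2 + uphalf n /\ (uphalf n = n./2 \/ uphalf n = n./2.+1).
Proof. by rewrite uphalf_half; have := odd_double_half n; case: (odd n); lia. Qed.

(** * Ordered counts of edges and triangles under vertex deletion *)

Section Counting.
Set Implicit Arguments.
Unset Strict Implicit.
Variables (V : finType) (G : sgraph V).
Implicit Types (S A B : {set V}) (x y z u v : V).

Definition deg_in S x : nat := \sum_(y in S) G x y.
Definition cross A B : nat := \sum_(x in A) deg_in B x.
(** Counts are ordered: an edge counts twice in [arcs] ([arcsE]), a triangle six times in [triples]
    ([triplesE]), so degree sums need no division. *)
Definition arcs S : nat := cross S S.
Definition nbr S x : {set V} := [set y in S | G x y].
Definition triples S : nat := \sum_(x in S) arcs (nbr S x).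

Lemma cross_sym A B : cross A B = cross B A.
Proof.
rewrite /cross /deg_in exchange_big; apply: eq_bigr => x _.
by apply: eq_bigr => y _; rewrite adj_sym.
Qed.

Lemma cross_leq A B : cross A B <= #|A| * #|B|.
Proof.
rewrite -sum_nat_const leq_sum // => x _; rewrite -sum1_card leq_sum // => y _.
exact: leq_b1.
Qed.

Lemma deg_inD1 S u x : u \in S -> deg_in S x = G x u + deg_in (S :\ u) x.
Proof. by move=> uS; rewrite /deg_in (big_setD1 u). Qed.

Lemma arcsD1 S u : u \in S -> arcs S = arcs (S :\ u) + 2 * deg_in S u.
Proof.
move=> uS; rewrite /arcs /cross (big_setD1 u) //=.
under eq_bigr => x _ do rewrite (deg_inD1 x uS).
rewrite big_split /=.
have -> : \sum_(x in S :\ u) G x u = deg_in S u.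
  rewrite (deg_inD1 _ uS) adj_irr add0n.
  by apply: eq_bigr => x _; rewrite adj_sym.
lia.
Qed.

Lemma arcs0 : arcs set0 = 0.
Proof. by rewrite /arcs /cross big_set0. Qed.

Lemma set_ind (P : {set V} -> Prop) :
  P set0 -> (forall S u, u \in S -> P (S :\ u) -> P S) -> forall S, P S.
Proof.
move=> P0 PD S; move cS: #|S| => c; elim: c S cS => [|c IH] S cS.
  by move/eqP: cS; rewrite cards_eq0 => /eqP ->.
have /card_gt0P [u uS] : 0 < #|S| by rewrite cS.
by apply: (PD S u uS); apply: IH; move: cS; rewrite (cardsD1 u) uS => -[].
Qed.

Lemma arcs_leq S : arcs S + #|S| <= #|S| * #|S|.
Proof.
elim/set_ind: S => [|S u uS IH]; first by rewrite arcs0 cards0.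
rewrite (arcsD1 uS) (cardsD1 u) uS add1n.
have : deg_in S u <= #|S :\ u|.
  rewrite (deg_inD1 _ uS) adj_irr add0n -sum1_card leq_sum // => y _.
  exact: leq_b1.
move: IH; nia.
Qed.


Lemma deg_inE S x : deg_in S x = #|nbr S x|.
Proof.
rewrite /deg_in -sum1dep_card big_mkcondr; apply: eq_bigr => y _.
by case: (G x y).
Qed.

Lemma sum_nbr S x (F : V -> nat) :
  \sum_(y in nbr S x) F y = \sum_(y in S) G x y * F y.
Proof.
rewrite big_set big_mkcondr; apply: eq_bigr => y _.
by case: (G x y); rewrite ?mul1n ?mul0n.
Qed.

Lemma nbrD1 S u x : nbr (S :\ u) x = nbr S x :\ u.
Proof. by apply/setP => y; rewrite !inE andbA. Qed.

Lemma setD1_notin S u : u \notin S -> S :\ u = S.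
Proof.
move=> uS; apply/setP => x; rewrite !inE andbC; case: eqP => [->|_].
  by rewrite (negPf uS).
by rewrite andbT.
Qed.

(** An ordered triangle with [u] in a fixed position is an arc inside [nbr S u], and there are three
    positions. *)
Lemma triplesD1 S u : u \in S ->
  triples S = triples (S :\ u) + 3 * arcs (nbr S u).
Proof.
move=> uS; rewrite /triples (big_setD1 u) //=.
have step x : x \in S :\ u ->
    arcs (nbr S x) = arcs (nbr (S :\ u) x) + 2 * (G u x * deg_in (nbr S u) x).
  move=> _; rewrite nbrD1; have [Gux|nGux] := boolP (G u x); last first.
    rewrite muln0 addn0 setD1_notin // inE negb_and adj_sym.
    by rewrite (negPf nGux) orbT.
  rewrite (arcsD1 (u := u)) ?inE ?uS 1?adj_sym // mul1n.
  congr (_ + 2 * _); rewrite !deg_inE; congr #|pred_of_set _|.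
  by apply/setP => y; rewrite !inE -!andbA [G u y && _]andbC.
rewrite (eq_bigr _ step) big_split /= -big_distrr /=.
have -> : \sum_(x in S :\ u) G u x * deg_in (nbr S u) x = arcs (nbr S u).
  rewrite /arcs /cross sum_nbr [RHS](big_setD1 u) //=.
  by rewrite adj_irr mul0n add0n.
lia.
Qed.

Lemma triples0 : triples set0 = 0.
Proof. by rewrite /triples big_set0. Qed.

(** Adjacent [x] and [y] have at least d(x) + d(y) - |S| common neighbours; summed over all arcs
    this is [tripD]. Cauchy-Schwarz then bounds [arcs S ^ 2] by [#|S| * D]. *)
Lemma moon_moser S :
  2 * arcs S ^ 2 <= #|S| * triples S + #|S| ^ 2 * arcs S.
Proof.
pose D := \sum_(x in S) deg_in S x ^ 2.
have tripD : 2 * D <= triples S + #|S| * arcs S.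
  have arcsE : arcs S = \sum_(x in S) \sum_(y in nbr S x) 1.
    by apply: eq_bigr => x _; rewrite sum1_card deg_inE.
  have DE1 : D = \sum_(x in S) \sum_(y in nbr S x) deg_in S x.
    by apply: eq_bigr => x _; rewrite sum_nat_const -deg_inE.
  have DE2 : D = \sum_(x in S) \sum_(y in nbr S x) deg_in S y.
    rewrite (eq_bigr _ (fun x _ => sum_nbr S x _)) exchange_big /=.
    apply: eq_bigr => y _; rewrite -big_distrl /=.
    by under eq_bigr => x _ do rewrite adj_sym.
  rewrite mul2n -addnn {1}DE1 DE2 -big_split arcsE big_distrr -big_split /=.
  apply: leq_sum => x xS; rewrite big_distrr /arcs /cross -!big_split /=.
  apply: leq_sum => y _; rewrite muln1 !deg_inE -cardsUI addnC leq_add //.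
    by apply/subset_leq_card/subsetP => z; rewrite !inE; case: (z \in S) => //= ->.
  by apply/subset_leq_card/subsetP => z; rewrite !inE; case: (z \in S).
have cauchy : arcs S ^ 2 <= #|S| * D.
  rewrite -(leq_pmul2l (isT : 0 < 2)) [X in 2 * X <= _]expnS expn1.
  rewrite {1 2}/arcs /cross big_distrlr /= big_distrr /=.
  have -> : 2 * (#|S| * D)
      = \sum_(x in S) \sum_(y in S) (deg_in S x ^ 2 + deg_in S y ^ 2).
    under eq_bigr => x _ do rewrite big_split /= sum_nat_const.
    by rewrite big_split /= -big_distrr sum_nat_const addnn mul2n.
  apply: leq_sum => x _; rewrite big_distrr; apply: leq_sum => y _.
  exact: nat_Cauchy.
nia.
Qed.

(** * Cliques as sets, and the link with [triangles] *)

Definition clique (A : {set V}) : bool :=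
  [forall x in A, forall y in A, (x != y) ==> G x y].
Definition cliques k S : {set {set V}} :=
  [set A : {set V} | [&& A \subset S, #|A| == k & clique A]].

Lemma cliqueP A :
  reflect {in A &, forall x y, x != y -> G x y} (clique A).
Proof.
apply: (iffP forall_inP) => [cA x y xA yA xy|cA x xA].
  by move/forall_inP: (cA x xA) => /(_ y yA) /implyP /(_ xy).
by apply/forall_inP => y yA; apply/implyP; apply: cA.
Qed.

Lemma card_cliques0 k : #|cliques k.+1 set0| = 0.
Proof.
apply/eqP; rewrite cards_eq0; apply/eqP/setP => A; rewrite !inE subset0.
by case: eqP => // ->; rewrite cards0.
Qed.

(** Adding [u] is a bijection from the [k]-cliques inside [nbr S u] to the [k.+1]-cliques of [S]
    through [u]. *)
Lemma card_cliquesD1 k S u : u \in S ->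
  #|cliques k.+1 S| = #|cliques k.+1 (S :\ u)| + #|cliques k (nbr S u)|.
Proof.
move=> uS; rewrite -(cardsID [set A : {set V} | u \in A]) addnC; congr (_ + _).
  by apply: eq_card => A; rewrite !inE subsetD1 -andbA andbCA.
pose f (A : {set V}) := u |: A.
have uN A : A \in cliques k (nbr S u) -> u \notin A.
  rewrite inE => /and3P [/subsetP AN _ _]; apply/negP => /AN.
  by rewrite !inE adj_irr andbF.
rewrite -(card_in_imset (f := f) (D := cliques k (nbr S u))); last first.
  by move=> A B /uN uA /uN uB fAB; rewrite -(setU1K uA) -(setU1K uB) -/(f A) fAB.
apply: eq_card => A; apply/idP/imsetP => [|[B BN ->]].
  rewrite !inE => /andP [/and3P [AS cA /cliqueP kA] uA]; exists (A :\ u).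
    rewrite !inE; apply/and3P; split.
    - apply/subsetP => x; rewrite !inE => /andP [xu xA].
      by rewrite (subsetP AS) //= kA // eq_sym.
    - by move: cA; rewrite (cardsD1 u) uA.
    - by apply/cliqueP => x y; rewrite !inE => /andP [_ ?] /andP [_ ?]; apply: kA.
  by rewrite /f setD1K.
have uB := uN _ BN; move: BN; rewrite !inE eqxx /= andbT.
case/and3P => /subsetP BN cB /cliqueP kB; apply/and3P; split.
- apply/subsetP => x; rewrite !inE => /orP [/eqP -> //|/BN].
  by rewrite inE => /andP [].
- by rewrite cardsU1 uB.
- apply/cliqueP => x y; rewrite !inE.
  case/orP => [/eqP->|xB] /orP [/eqP->|yB]; rewrite ?eqxx // => xy.
  + by move: (BN y yB); rewrite inE => /andP [].
  + by move: (BN x xB); rewrite inE adj_sym => /andP [].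
  + exact: kB.
Qed.

Lemma card_cliques1 S : #|cliques 1 S| = #|S|.
Proof.
elim/set_ind: S => [|S u uS IH]; first by rewrite card_cliques0 cards0.
rewrite (card_cliquesD1 _ uS) IH [in RHS](cardsD1 u) uS addnC; congr (_ + _).
rewrite (_ : cliques 0 _ = [set set0]) ?cards1 //; apply/setP => A.
rewrite !inE cards_eq0 andbCA; case: eqP => //= ->.
by rewrite sub0set; apply/cliqueP => x y; rewrite inE.
Qed.

Lemma arcsE S : arcs S = 2 * #|cliques 2 S|.
Proof.
elim/set_ind: S => [|S u uS IH]; first by rewrite card_cliques0 arcs0.
by rewrite (arcsD1 uS) (card_cliquesD1 _ uS) IH card_cliques1 deg_inE mulnDr.
Qed.

Lemma triplesE S : triples S = 6 * #|cliques 3 S|.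
Proof.
elim/set_ind: S => [|S u uS IH]; first by rewrite card_cliques0 triples0.
rewrite (triplesD1 uS) (card_cliquesD1 _ uS) IH arcsE; lia.
Qed.

Lemma triplesT : triples [set: V] = 6 * triangles G.
Proof.
rewrite triplesE; congr (6 * _); apply: eq_card => A.
by rewrite !inE subsetT.
Qed.


Lemma sum_disjointU A B (F : V -> nat) : [disjoint A & B] ->
  \sum_(x in A :|: B) F x = \sum_(x in A) F x + \sum_(x in B) F x.
Proof. by move=> dAB; rewrite -bigU //; apply: eq_bigl => x; rewrite !inE. Qed.

Lemma arcs_disjointU A B : [disjoint A & B] ->
  arcs (A :|: B) = arcs A + arcs B + 2 * cross A B.
Proof.
move=> dAB; have crossU C : cross C (A :|: B) = cross C A + cross C B.
  rewrite /cross -big_split; apply: eq_bigr => x _; exact: sum_disjointU.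
rewrite /arcs {1}/cross sum_disjointU // -!/(cross _ _) !crossU (cross_sym B A).
lia.
Qed.

(** * Deleting the ends of an edge that lies in no triangle *)

Section TriangleFreeEdge.
Variables (S : {set V}) (u v : V).
Hypotheses (uS : u \in S) (vS : v \in S) (Guv : G u v).
Hypothesis nbr_disj : [disjoint nbr S u & nbr S v].

Let vSu : v \in S :\ u.
Proof. by rewrite !inE vS andbT; apply: contraTneq Guv => ->; rewrite adj_irr. Qed.

(** The edge [u v] is counted in both degrees, hence the 2 on the left. *)
Lemma arcsD2 :
  arcs S + 2 = arcs (S :\ u :\ v) + 2 * (deg_in S u + deg_in S v).
Proof.
rewrite (arcsD1 uS) (arcsD1 vSu).
rewrite (deg_inD1 v uS) adj_sym Guv; lia.
Qed.

(** Deleting [u] first does not change the arcs inside [nbr S v], where [u] has no neighbour. *)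
Lemma triplesD2 : triples S =
  triples (S :\ u :\ v) + 3 * (arcs (nbr S u) + arcs (nbr S v)).
Proof.
rewrite (triplesD1 uS) (triplesD1 vSu) nbrD1.
have uNv : u \in nbr S v by rewrite !inE uS adj_sym.
rewrite (arcsD1 uNv) deg_inE (_ : nbr (nbr S v) u = set0) ?cards0; first lia.
apply/setP => x; rewrite !inE; apply/negP => /andP [/andP [xS vx] ux].
by have /disjointFl := nbr_disj => /(_ x); rewrite !inE xS vx ux => /(_ isT).
Qed.

Lemma card_nbrU : #|nbr S u :|: nbr S v| = deg_in S u + deg_in S v.
Proof. by rewrite cardsU (disjoint_setI0 nbr_disj) cards0 subn0 !deg_inE. Qed.

Lemma deg_inD_leq : deg_in S u + deg_in S v <= #|S|.
Proof.
rewrite -card_nbrU; apply/subset_leq_card/subsetP => x; rewrite !inE.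
by case/orP => /andP [].
Qed.

Lemma nbrU_full : deg_in S u + deg_in S v = #|S| -> nbr S u :|: nbr S v = S.
Proof.
move=> dS; apply/eqP; rewrite eqEcard card_nbrU dS leqnn andbT.
by apply/subsetP => x; rewrite !inE => /orP [] /andP [].
Qed.

Lemma card_SD2 : #|S| = (#|S :\ u :\ v|).+2.
Proof. by rewrite (cardsD1 u) uS (cardsD1 v (S :\ u)) vSu. Qed.

End TriangleFreeEdge.

(** * Rademacher's lower bound *)

Definition covered S : bool :=
  [forall x in S, forall y in S, G x y ==> ~~ [disjoint nbr S x & nbr S y]].

Lemma covered_triples S : covered S -> arcs S <= triples S.
Proof.
move/forall_inP => cS; rewrite /arcs /triples {1}/cross; apply: leq_sum => x xS.
rewrite deg_inE -sum1_card; apply: leq_sum => y; rewrite inE => /andP [yS Gxy].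
have /forall_inP /(_ y yS) := cS x xS; rewrite Gxy deg_inE card_gt0 /=.
apply: contra => /eqP N0; rewrite disjoints_subset; apply/subsetP => z zx.
by rewrite inE; apply/negP => zy; move/setP: N0 => /(_ z); rewrite !inE;
  move: zx zy; rewrite !inE => /andP [-> ->] /andP [_ ->].
Qed.

Lemma uncovered S : ~~ covered S ->
  exists u v, [/\ u \in S, v \in S, G u v & [disjoint nbr S u & nbr S v]].
Proof.
rewrite negb_forall_in => /exists_inP [u uS]; rewrite negb_forall_in.
case/exists_inP => v vS; rewrite negb_imply negbK => /andP [Guv dis].
by exists u, v.
Qed.

Lemma arcs_gt S m : 2 * m < arcs S -> 2 * m + 2 <= arcs S.
Proof. by rewrite arcsE; lia. Qed.

(** By parity [arcs S] is at least 2kp + 4, where Moon-Moser contradicts having at most k + 1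
    triangles. *)
Lemma arcs_surplus S : let k := #|S|./2 in let p := uphalf #|S| in
  2 * (k * p) + 2 < arcs S -> 6 * k.+1 < triples S.
Proof.
move=> k p aS; have := moon_moser S; have := @arcs_gt S (k * p + 1).
have [nE pk] := half_uphalf #|S|; rewrite -/k -/p in nE pk.
move: aS; set a := arcs S; set t := triples S; rewrite nE => aS /(_ ltac:(lia)) aS2.
move=> MM; rewrite ltnNge; apply/negP => tk.
have [r aE] : exists r, a = 2 * (k * p) + 4 + r by exists (a - (2 * (k * p) + 4)); lia.
have /(leq_trans MM) : (k + p) * t + (k + p) ^ 2 * a
    <= (k + p) * (6 * k.+1) + (k + p) ^ 2 * a by rewrite leq_add2r leq_mul2l tk orbT.
by rewrite aE; case: pk => ->; [exact: surplus_even|exact: surplus_odd].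
Qed.

Lemma covered_extremal S : let k := #|S|./2 in let p := uphalf #|S| in
  2 * (k * p) < arcs S -> covered S ->
  6 * k <= triples S /\ (triples S = 6 * k ->  #|S| <= 4).
Proof.
move=> k p /arcs_gt aS /covered_triples ta; have aS2 := arcs_leq S.
have [nE pk] := half_uphalf #|S|; rewrite -/k -/p in nE pk.
have tE := triplesE S.
move: aS ta aS2 tE; set a := arcs S; set t := triples S; rewrite nE => aS ta aS2 tE.
(* For k >= 3, [arcs S] exceeds 2kp >= 6p >= 6k, so equality is excluded. Smaller k are checked one
   by one, using [arcs_leq] and the divisibility of [triples S] by 6. *)
have [k3|k3] := leqP 3 k; first by have : 3 * p <= k * p by [rewrite leq_mul2r k3 orbT]; case: pk => pk; lia.
have : k = 0 \/ k = 1 \/ k = 2 by lia.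
by case: pk aS aS2 => -> aS aS2 [|[|]] kE; move: aS aS2; rewrite kE; lia.
Qed.

Section FreeEdgeSurplus.
Variables (S : {set V}) (u v : V).
Hypotheses (uS : u \in S) (vS : v \in S) (Guv : G u v).
Hypothesis nbr_disj : [disjoint nbr S u & nbr S v].
Let k := #|S|./2.
Let p := uphalf #|S|.
Hypothesis aS : 2 * (k * p) < arcs S.
Let A := nbr S u.
Let B := nbr S v.

(** The set without [u], [v] has bipartite bound kp - |S| + 1. With a smaller degree sum it would
    satisfy [arcs_surplus] and contain more than k triangles. *)
Lemma free_edge_deg : triples S <= 6 * k -> deg_in S u + deg_in S v = #|S|.
Proof.
move=> tS; apply/eqP; rewrite eqn_leq deg_inD_leq //= leqNgt; apply/negP => dS.
have := arcs_surplus (S := S :\ u :\ v); have := arcsD2 uS vS Guv.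
have := triplesD2 uS vS Guv nbr_disj; move: tS dS aS; rewrite /k /p.
have [nE _] := half_uphalf #|S|; rewrite (card_SD2 uS vS Guv) /= in nE *.
move: nE; set k' := _./2; set p' := uphalf _ => nE tS dS a0 tE aE.
move=> /(_ ltac:(lia)); lia.
Qed.

Lemma free_edge_inner : deg_in S u + deg_in S v = #|S| ->
  [/\ 2 <= arcs A + arcs B, arcs S = arcs A + arcs B + 2 * cross A B,
      #|A| + #|B| = #|S| & #|A| * #|B| <= k * p].
Proof.
move=> dS; have SE : arcs S = arcs A + arcs B + 2 * cross A B.
  by rewrite -arcs_disjointU // (nbrU_full nbr_disj dS).
have cardAB : #|A| + #|B| = #|S| by rewrite -!deg_inE.
have AB : #|A| * #|B| <= k * p.
  have [nE pk] := half_uphalf #|S|; rewrite -/k -/p in nE pk.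
  (* AM-GM gives 4|A||B| <= (k + p)^2; integrality absorbs the extra 1 when p = k + 1. *)
  have := nat_AGM2 #|A| #|B|; rewrite cardAB nE => -[+ _].
  by rewrite expnS expn1; case: pk => ->; lia.
split=> //; have := aS; have := cross_leq A B; rewrite SE.
by have := arcsE A; have := arcsE B; lia.
Qed.

(** When the degree sum is |S|, the deletion lowers the number of edges and the bipartite bound by
    the same |S| - 1. *)
Lemma free_edge_triples :
  2 * ((#|S :\ u :\ v|)./2 * uphalf #|S :\ u :\ v|) < arcs (S :\ u :\ v) \/
  6 * k < triples S.
Proof.
have [tS|] := leqP (triples S) (6 * k); [left | by right].
have dS := free_edge_deg tS; have := arcsD2 uS vS Guv; have := aS; rewrite dS /k /p.
have [nE _] := half_uphalf #|S|; rewrite (card_SD2 uS vS Guv) /= in nE *.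
by move: nE; set k' := _./2; set p' := uphalf _ => nE; lia.
Qed.

End FreeEdgeSurplus.

Lemma rademacher S : let k := #|S|./2 in let p := uphalf #|S| in
  2 * (k * p) < arcs S -> 6 * k <= triples S.
Proof.
have [c cS] := ubnP #|S|; elim: c S cS => // c IH S cS k p aS.
have [cov|/uncovered [u [v [uS vS Guv dis]]]] := boolP (covered S).
  by have [] := covered_extremal aS cov.
have [aS'|] := free_edge_triples uS vS Guv dis aS; last exact: ltnW.
have cS2 := card_SD2 uS vS Guv.
have := IH (S :\ u :\ v) ltac:(lia) aS'.
rewrite /k leqNgt => tS'; rewrite leqNgt; apply/negP => tS.
have dS := free_edge_deg uS vS Guv dis aS (ltnW tS).
have [ge2 _ _ _] := free_edge_inner uS vS Guv dis aS dS.
(* The smaller set supplies 6(k - 1); the arcs inside the neighbourhoods, at least 2 with weight 3,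
   supply the missing 6. *)
have := triplesD2 uS vS Guv dis; move: tS tS'; rewrite -/k /k cS2 /=; lia.
Qed.

(** * Shape of the extremal graph *)

Lemma arcs_eq0 S x y : arcs S = 0 -> x \in S -> y \in S -> G x y = false.
Proof.
move=> a0 xS yS; apply/negP => Gxy; have := arcsD1 xS.
rewrite a0 deg_inE; suff : 0 < #|nbr S x| by lia.
by apply/card_gt0P; exists y; rewrite inE yS.
Qed.

Lemma arcs_eq2 S : arcs S = 2 -> exists a b, [/\ a \in S, b \in S, a != b &
  {in S &, forall x y, G x y = [&& x != y, x \in [set a; b] & y \in [set a; b]]}].
Proof.
rewrite arcsE => a2; have /eqP/cards1P [C CE] : #|cliques 2 S| = 1 by lia.
have : C \in cliques 2 S by rewrite CE set11.
rewrite inE => /and3P [/subsetP CS /cards2P [a [b [ab CE']]] /cliqueP kC].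
exists a, b; split=> //; try by apply: CS; rewrite CE' !inE eqxx ?orbT.
move=> x y xS yS; rewrite -CE'; apply/idP/and3P => [Gxy|[xy xC yC]]; last exact: kC.
have xy : x != y by apply: contraTneq Gxy => ->; rewrite adj_irr.
suff /eqP <- : [set x; y] == C by rewrite xy !inE !eqxx orbT.
rewrite -in_set1 -CE inE cards2 xy eqxx /=; apply/andP; split.
  by apply/subsetP => z; rewrite !inE => /orP [] /eqP ->.
apply/cliqueP => z t; rewrite !inE.
by do 2![case/orP => /eqP ->]; rewrite ?eqxx // adj_sym.
Qed.

(** [Kplus] without the numbering of its vertices; the size of [X] is stated separately. *)
Definition Kplus_on (X : {set V}) (a b : V) : Prop :=
  [/\ a \in X, b \in X, a != b &
   forall x y, G x y = ((x \in X) != (y \in X)) ||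
     [&& x != y, x \in [set a; b] & y \in [set a; b]]].

Lemma cross_full A B : cross A B = #|A| * #|B| ->
  forall x y, x \in A -> y \in B -> G x y.
Proof.
move=> cAB x y xA yB; apply: contraT => nG; have := leqnn (cross A B).
rewrite {1}cAB (cardsD1 x) xA /cross (big_setD1 x) //= -/(cross _ _).
have := cross_leq (A :\ x) B; rewrite /deg_in (big_setD1 y) //= (negPf nG) add0n.
have : \sum_(i in B :\ y) G x i <= #|B :\ y|.
  by rewrite -sum1_card leq_sum // => z _; apply: leq_b1.
rewrite (cardsD1 y B) yB; lia.
Qed.

(** Every vertex outside [X] is joined to both ends of the single edge inside [X] and closes a
    triangle on it. *)
Lemma near_bipartite (X : {set V}) : arcs X = 2 -> arcs (~: X) = 0 ->
  cross X (~: X) = #|X| * #|~: X| ->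
  6 * #|~: X| <= triples [set: V] /\ exists a b, Kplus_on X a b.
Proof.
move=> /arcs_eq2 [a [b [aX bX ab GX]]] aY /cross_full full; split; last first.
  exists a, b; split=> // x y.
  have abX z : z \notin X -> z \notin [set a; b].
    by apply: contra; rewrite !inE => /orP [] /eqP ->.
  have [xX|xX] := boolP (x \in X); have [yX|yX] := boolP (y \in X) => /=.
  - exact: GX.
  - by rewrite full // inE.
  - by rewrite adj_sym full // inE.
  - by rewrite (negPf (abX _ xX)) andbF (arcs_eq0 aY) ?inE.
rewrite (triplesD1 (in_setT a)).
have Gab : G a b by rewrite GX // ab !inE !eqxx orbT.
have bN : b \in nbr [set: V] a by rewrite !inE.
rewrite (arcsD1 bN) deg_inE.
suff : #|~: X| <= #|nbr (nbr [set: V] a) b| by lia.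
apply/subset_leq_card/subsetP => y yX.
by rewrite inE inE inE /= !full.
Qed.

End Counting.

(** * Equality in Rademacher's bound *)

Section Equality.
Set Implicit Arguments.
Unset Strict Implicit.
Variables (V : finType) (G : sgraph V).
Let n := #|V|.
Let k := n./2.
Let p := uphalf n.

Definition compl_rel : rel V := fun x y => (x != y) && ~~ G x y.
Lemma compl_sym : symmetric compl_rel.
Proof. by move=> x y; rewrite /compl_rel eq_sym adj_sym. Qed.
Lemma compl_irr : irreflexive compl_rel.
Proof. by move=> x; rewrite /compl_rel eqxx. Qed.
Definition compl : sgraph V := SGraph compl_sym compl_irr.

Lemma compl_adj x y : G x y = (x != y) && ~~ compl x y.
Proof. by rewrite /= /compl_rel; case: eqVneq => [->|]; rewrite ?adj_irr ?negbK. Qed.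

Lemma arcs_compl : arcs G [set: V] + arcs compl [set: V] + n = n * n.
Proof.
rewrite -addnA [RHS](_ : _ = \sum_(x in [set: V]) \sum_(y in [set: V]) 1); last first.
  under eq_bigr do rewrite sum1_card cardsT.
  by rewrite sum_nat_const cardsT.
have -> : n = \sum_(x in [set: V]) 1 by rewrite sum1_card cardsT.
rewrite /arcs /cross -!big_split; apply: eq_bigr => x _ /=.
rewrite [X in _ + (_ + X) = _](_ : 1 = \sum_(y in [set: V]) (x == y)); last first.
  rewrite (big_setD1 x) ?inE //= eqxx big1 // => y; rewrite !inE andbT eq_sym.
  by move/negPf => ->.
rewrite /deg_in -!big_split; apply: eq_bigr => y _ /=; rewrite /compl_rel.
by case: eqVneq => [->|_]; [rewrite adj_irr|case: (G x y)].
Qed.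

Lemma Kplus_on_compl (Y : {set V}) : #|~: Y| = 2 ->
  (forall x y, G x y = (x != y) && ~~ ((x \in Y) && (y \in Y))) ->
  exists a b, Kplus_on G (~: Y) a b.
Proof.
move/eqP/cards2P => [a [b [ab YE]]] GE; exists a, b.
split=> //; try by rewrite YE !inE eqxx ?orbT.
move=> x y; rewrite GE -YE !inE; case: (eqVneq x y) => [->|xy] /=; first by rewrite eqxx.
by case: (x \in Y); case: (y \in Y).
Qed.

Lemma covered_Kplus_on : 3 <= n -> n <= 4 -> 2 * (k * p) < arcs G [set: V] ->
  triples G [set: V] = 6 * k -> covered G [set: V] ->
  exists (X : {set V}) a b, #|X| = p /\ Kplus_on G X a b.
Proof.
move=> n3 n4 aG tG /covered_triples ta.
have cE := arcs_compl; have aG2 := arcs_gt aG.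
have ns := @arcs_surplus _ G [set: V]; rewrite cardsT -/n -/k -/p /= in ns.
have n34 : n = 3 \/ n = 4 by lia.
(* Common form of the triangle and of K_4 minus an edge: all pairs are adjacent except those inside
   [Y]. *)
suff [Y [Y2 GE]] : exists Y : {set V}, #|~: Y| = 2 /\
    forall x y, G x y = (x != y) && ~~ ((x \in Y) && (y \in Y)).
  have [a [b Kab]] := Kplus_on_compl Y2 GE; exists (~: Y), a, b; split=> //.
  by rewrite Y2 /p; case: n34 => ->.
case: n34 => nE.
  have /card_gt0P [c _] : 0 < #|V| by rewrite -/n nE.
  exists [set c]; split; first by have := cardsC1 c; rewrite -/n nE.
  have c0 : arcs compl [set: V] = 0 by move: aG2 cE; rewrite /k /p nE /=; lia.
  move=> x y; rewrite compl_adj (arcs_eq0 c0) ?inE //= andbT.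
  by case: eqVneq => //= xy; case: eqVneq => // <-; rewrite eq_sym (negPf xy).
(* Six edges would give more than three triangles by [arcs_surplus], against [tG]; so exactly one
   edge is missing. *)
have c2 : arcs compl [set: V] = 2.
  move: aG2 cE ns tG ta; rewrite /k /p nE /= => aG2 cE ns tG ta; apply/eqP.
  have := arcsE G [set: V]; lia.
have [a [b [_ _ ab cab]]] := arcs_eq2 c2.
exists [set a; b]; split.
  by have := cardsC [set a; b]; rewrite -/n nE cards2 ab; lia.
by move=> x y; rewrite compl_adj cab ?inE //; case: (x != y).
Qed.

Lemma rademacher_eq : 3 <= n -> 2 * (k * p) < arcs G [set: V] ->
  triples G [set: V] = 6 * k -> exists (X : {set V}) a b, #|X| = p /\ Kplus_on G X a b.
Proof.
move=> n3 aG tG; have nT : #|[set: V]| = n by rewrite cardsT.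
have [cov|/uncovered [u [v [uS vS Guv dis]]]] := boolP (covered G [set: V]).
  have [] := covered_extremal (G := G) (S := [set: V]) _ cov; rewrite nT // => _.
  by move=> /(_ tG) n4; apply: covered_Kplus_on.
have aG' : 2 * (#|[set: V]|./2 * uphalf #|[set: V]|) < arcs G [set: V] by rewrite nT.
have dS : deg_in G [set: V] u + deg_in G [set: V] v = #|[set: V]|.
  by apply: free_edge_deg => //; rewrite nT tG.
have [ge2 aE cAB mAB] := free_edge_inner uS vS Guv dis aG' dS.
have tE := triplesD2 uS vS Guv dis.
have BA : nbr G [set: V] v = ~: nbr G [set: V] u.
  apply/eqP; rewrite eqEcard; apply/andP; split.
    by rewrite -disjoints_subset disjoint_sym.
  by have := cardsC (nbr G [set: V] u); rewrite -/n -nT -cAB; lia.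
move: ge2 aE cAB mAB tE; rewrite BA; set A := nbr G _ u => ge2 aE cAB mAB tE.
have [nE pk] := half_uphalf n; rewrite -/k -/p in nE pk; rewrite nT -/k -/p in mAB cAB.
have tS' : 6 * k.-1 <= triples G ([set: V] :\ u :\ v).
  have := free_edge_triples uS vS Guv dis aG'; rewrite nT -/k tG ltnn => -[/rademacher|//].
  have := card_SD2 uS vS Guv; rewrite nT => nE2; rewrite /k nE2 /=; lia.
(* The smaller set already accounts for 6(k - 1) of the 6k, leaving room for one inner edge only. *)
have sum2 : arcs G A + arcs G (~: A) = 2 by lia.
have cross_max : cross G A (~: A) = k * p.
  have := cross_leq G A (~: A); have := arcs_gt aG; lia.
have cross_card : cross G A (~: A) = #|A| * #|~: A|.
  by apply/eqP; rewrite eqn_leq cross_leq cross_max.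
(* [X] is the part holding the inner edge. [near_bipartite] gives |~: X| <= k, and the product kp
   with sum k + p then forces |X| = p. *)
have Xp (X : {set V}) : arcs G X = 2 -> arcs G (~: X) = 0 ->
    cross G X (~: X) = #|X| * #|~: X| -> #|X| * #|~: X| = k * p ->
    exists (X : {set V}) a b, #|X| = p /\ Kplus_on G X a b.
  move=> a2 a0 cX Xkp; have [Xk [a [b Kab]]] := near_bipartite a2 a0 cX.
  exists X, a, b; split=> //; have := cardsC X; rewrite -/n.
  move: Xk Xkp; rewrite tG; set x := #|X|; set y := #|~: X| => yk xy xyn.
  have [d dE] : exists d, k = y + d by exists (k - y); lia.
  have xE : x = p + d by lia.
  have /eqP : d * y = d * p by move: xy; rewrite dE xE mulnDl mulnDl; lia.
  by rewrite eqn_mul2l => /orP [] /eqP; lia.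
have eA := arcsE G A; have eB := arcsE G (~: A).
have [a0|a2] : arcs G A = 0 \/ arcs G A = 2 by lia.
  apply: (Xp (~: A)); rewrite ?setCK ?[cross _ _ A]cross_sym ?cross_card //; try lia.
by apply: (Xp A) => //; lia.
Qed.

End Equality.

(** * Identification with [Kplus], and its triangles *)

Section KplusIso.
Set Implicit Arguments.
Unset Strict Implicit.
Variables (V : finType) (G : sgraph V).

Lemma Kplus_on_isomorphic n (X : {set V}) (a b : V) : #|V| = n ->
  #|X| = uphalf n -> Kplus_on G X a b -> isomorphic G (Kplus n).
Proof.
move=> nV Xp [aX bX ab GE].
(* The list follows the numbering of [Kplus]: ends of the added edge, rest of the larger part,
   smaller part. The isomorphism is the index in it. *)
pose s1 := [:: a, b & enum (X :\ a :\ b)].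
pose s := s1 ++ enum (~: X).
have bXa : b \in X :\ a by rewrite !inE eq_sym ab.
have size_s1 : size s1 = #|X|.
  by rewrite /= -cardE (cardsD1 a X) aX (cardsD1 b (X :\ a)) bXa.
have mem_s1 x : (x \in s1) = (x \in X).
  rewrite !inE mem_enum !inE; have [->|xa] := eqVneq x a; first by rewrite aX.
  by have [->|xb] := eqVneq x b; first by rewrite bX.
have mem_s x : x \in s.
  by rewrite mem_cat mem_s1 mem_enum inE orbN.
have size_s : size s = n.
  by rewrite size_cat size_s1 -cardE cardsC.
have lt_s x : index x s < n by rewrite -size_s index_mem.
pose f x : 'I_n := Ordinal (lt_s x).
have f_inj : injective f.
  move=> x y fxy; have ixy : index x s = index y s := congr1 val fxy.
  by rewrite -(nth_index a (mem_s x)) ixy nth_index.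
have fX x : (f x < uphalf n) = (x \in X).
  rewrite -[nat_of_ord _]/(index x s) -Xp -size_s1 index_cat mem_s1; case: ifP => [xX|_].
    by rewrite index_mem mem_s1.
  by rewrite ltnNge leq_addr.
have fab x : (f x < 2) = (x \in [set a; b]).
  rewrite -[nat_of_ord _]/(index x s) /= !inE ![_ == x]eq_sym; case: eqP => //= _; by case: eqP.
exists f; first by apply: inj_card_bij f_inj _; rewrite card_ord nV.
by move=> x y; rewrite GE -!fX -!fab /= /Kplus_rel (inj_eq f_inj).
Qed.
End KplusIso.

Lemma triangles_isomorphic (V W : finType) (G : sgraph V) (H : sgraph W) :
  isomorphic G H -> triangles G <= triangles H.
Proof.
move=> [f [g fK gK] GH]; have f_inj := can_inj fK.
rewrite /triangles -(card_imset _ (imset_inj f_inj)).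
apply/subset_leq_card/subsetP => _ /imsetP [A + ->]; rewrite !inE card_imset //.
case/andP => -> /= /cliqueP cA; apply/(cliqueP H) => fx fy.
move=> /imsetP [x xA ->] /imsetP [y yA ->]; rewrite (inj_eq f_inj) GH; exact: cA.
Qed.

(** The smaller part is independent and 0, 1 is the only edge inside the larger one, so every
    triangle is {0, 1, p + j} with j < k. *)
Lemma triangles_Kplus n : 3 <= n -> triangles (Kplus n) <= n./2.
Proof.
move=> n3; have [nE pk] := half_uphalf n.
case: n n3 nE pk => // n n3; set m := n.+1; set k := m./2; set p := uphalf m => nE pk.
pose f (j : 'I_k) : {set 'I_m} := [set inord 0; inord 1; inord (p + j)].
rewrite -[leqRHS](card_ord k); apply: leq_trans (leq_imset_card f 'I_k).
apply/subset_leq_card/subsetP => A; rewrite inE => /andP [/eqP A3 /cliqueP cA].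
have n1 : 1 < n.+1 by lia.
have i01 x y : x \in A -> y \in A -> x != y -> x < p -> y < p ->
    [set x; y] = [set inord 0; inord 1].
  move=> xA yA xy xp yp; have := cA x y xA yA xy.
  rewrite /= /Kplus_rel xp yp eqxx /= => /and3P [_ x2 y2].
  apply/eqP; rewrite eqEcard !cards2 xy; apply/andP; split; last by case: (_ != _).
  by apply/subsetP => z; rewrite !inE -!val_eqE /= !inordK //; case/orP => /eqP ->; lia.
(* Among three vertices below [p], any two would form the pair {0, 1}. *)
have [c cA' pc] : exists2 c, c \in A & p <= c.
  apply/exists_inP; apply: contraT; rewrite negb_exists_in => /forall_inP Ap.
  have [x xA] : exists x, x \in A by apply/card_gt0P; rewrite A3.
  have /cards2P [y [z [yz Ayz]]] : #|A :\ x| == 2 by have := cardsD1 x A; rewrite xA; lia.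
  have : y \in A :\ x by rewrite Ayz !inE eqxx.
  have : z \in A :\ x by rewrite Ayz !inE eqxx orbT.
  rewrite !inE => /andP [zx zA] /andP [yx yA].
  have lt t : t \in A -> t < p by move/Ap; rewrite -ltnNge.
  have : z \in [set x; y] by rewrite i01 ?lt // 1?eq_sym // -(i01 x z) ?lt // 1?eq_sym // !inE eqxx orbT.
  by rewrite !inE (negPf zx) eq_sym (negPf yz).
have /cards2P [x [y [xy Axy]]] : #|A :\ c| == 2 by have := cardsD1 c A; rewrite cA'; lia.
have : x \in A :\ c by rewrite Axy !inE eqxx.
have : y \in A :\ c by rewrite Axy !inE eqxx orbT.
rewrite !inE => /andP [yc yA] /andP [xc xA].
have lt t : t \in A -> t != c -> t < p.
  move=> tA tc; have := cA t c tA cA' tc; rewrite /= /Kplus_rel [c < _]ltnNge pc /=.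
  by case: (t < p) => //= /and3P [_ _]; lia.
have ck : c - p < k by have := ltn_ord c; lia.
apply/imsetP; exists (Ordinal ck) => //.
rewrite /f /= subnKC // inord_val -(i01 x y) ?lt // -Axy.
by rewrite setUC setD1K.
Qed.

Import Order.TTheory GRing.Theory Num.Theory.
Local Open Scope ring_scope.

(** * Trace inequalities for symmetric matrices *)

Section Trace.
Set Implicit Arguments.
Unset Strict Implicit.
Variable R : realFieldType.

(** Lagrange's identity: the sum of squares is twice the difference of the two sides. *)
Lemma sum_cauchy_schwarz (I : finType) (a b : I -> R) :
  (\sum_i a i * b i) ^+ 2 <= (\sum_i a i ^+ 2) * (\sum_i b i ^+ 2).
Proof.
have : 0 <= \sum_i \sum_j (a i * b j - a j * b i) ^+ 2.
  by apply: sumr_ge0 => i _; apply: sumr_ge0 => j _; apply: sqr_ge0.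
have -> : \sum_i \sum_j (a i * b j - a j * b i) ^+ 2 =
    \sum_i \sum_j (a i ^+ 2 * b j ^+ 2) + \sum_i \sum_j (b i ^+ 2 * a j ^+ 2)
    - (\sum_i \sum_j (a i * b i) * (a j * b j)
       + \sum_i \sum_j (a i * b i) * (a j * b j)).
  rewrite -!big_split -sumrB; apply: eq_bigr => i _ /=.
  rewrite -!big_split -sumrB; apply: eq_bigr => j _ /=; ring.
rewrite -!big_distrlr /=; lra.
Qed.

Lemma sqr_lerN (x y : R) : 0 <= y -> x ^+ 2 <= y ^+ 2 -> - y <= x.
Proof. by move=> y0 xy; rewrite leNgt; apply/negP => ?; nra. Qed.

Lemma mxtrace_mul_sym n (A B : 'M[R]_n) : B^T = B ->
  \tr (A *m B) = \sum_(ij : 'I_n * 'I_n) A ij.1 ij.2 * B ij.1 ij.2.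
Proof.
move=> Bs; rewrite /mxtrace -(pair_bigA _ (fun i j => A i j * B i j)) /=.
apply: eq_bigr => i _; rewrite mxE; apply: eq_bigr => j _.
by rewrite -[in LHS]Bs mxE.
Qed.

(** Cauchy-Schwarz for the Frobenius product of [B *m B] and [B], then again for each entry of
    [B *m B], a product of two rows of [B]. *)
Lemma mxtrace_cube_leq n (B : 'M[R]_n) : B^T = B ->
  (\tr (B *m B *m B)) ^+ 2 <= (\tr (B *m B)) ^+ 3.
Proof.
move=> Bs; rewrite !mxtrace_mul_sym //.
set F := \sum_ij B _ _ * B _ _.
have FE : F = \sum_(ij : 'I_n * 'I_n) B ij.1 ij.2 ^+ 2.
  by apply: eq_bigr => ij _; rewrite expr2.
apply: le_trans (sum_cauchy_schwarz _ _) _; rewrite -FE exprSr.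
apply: ler_wpM2r; first by rewrite FE sumr_ge0 // => ij _; apply: sqr_ge0.
have -> : F ^+ 2 = \sum_(ij : 'I_n * 'I_n)
    (\sum_k B ij.1 k ^+ 2) * (\sum_k B ij.2 k ^+ 2).
  rewrite -(pair_bigA _ (fun i j => (\sum_k B i k ^+ 2) * (\sum_k B j k ^+ 2))) /=.
  by rewrite -big_distrlr /= expr2 FE -(pair_bigA _ (fun i j => B i j ^+ 2)).
apply: ler_sum => -[i j] _ /=; rewrite mxE.
rewrite (eq_bigr (fun k => B i k * B j k)); last first.
  by move=> k _; rewrite -[in B k j]Bs mxE.
exact: sum_cauchy_schwarz.
Qed.

Lemma mulmx_row_col n (u v : 'rV[R]_n) : (u *m v^T) 0 0 = \sum_i u 0 i * v 0 i.
Proof. by rewrite mxE; apply: eq_bigr => i _; rewrite mxE. Qed.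

(* Deflating A by a unit vector w to B = A - mu w^T w lowers the sum of squares
   by exactly mu ^ 2, and tr (B ^ 3) <= tr (A ^ 3) - mu ^ 3 because
   |w A| ^ 2 >= mu ^ 2. *)
Lemma mxtrace_cube_rayleigh n (A : 'M[R]_n) (w : 'rV[R]_n) (b : R) :
  let mu := (w *m A *m w^T) 0 0 in
  A^T = A -> (w *m w^T) 0 0 = 1 -> 0 <= mu -> 0 <= b ->
  \tr (A *m A) - mu ^+ 2 <= b ^+ 2 -> mu ^+ 3 - b ^+ 3 <= \tr (A *m A *m A).
Proof.
move=> mu As w1 mu0 b0 Ab.
pose P := w^T *m w; pose B := A - mu *: P.
have w11 : w *m w^T = 1%:M by rewrite [LHS]mx11_scalar w1.
have Ps : P^T = P by rewrite /P trmx_mul trmxK.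
have PP : P *m P = P by rewrite /P mulmxA -[_ *m w^T]mulmxA w11 mulmx1.
have trP X : \tr (P *m X) = (w *m X *m w^T) 0 0.
  by rewrite /P -mulmxA mxtrace_mulC [X in \tr X]mx11_scalar mxtrace_scalar mulr1n.
have trP1 : \tr P = 1 by rewrite -[P]mulmx1 trP mulmx1 w1.
have PAP : P *m A *m P = mu *: P.
  have -> : P *m A *m P = w^T *m (w *m A *m w^T) *m w by rewrite /P !mulmxA.
  by rewrite [w *m A *m w^T]mx11_scalar mul_mx_scalar -scalemxAl.
have nu : mu ^+ 2 <= \tr (P *m (A *m A)).
  rewrite trP mulmxA -[_ *m A *m w^T]mulmxA -{2}As -trmx_mul.
  have := sum_cauchy_schwarz (fun i => (w *m A) 0 i) (fun i => w 0 i).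
  rewrite -mulmx_row_col -/mu [X in _ * X](_ : _ = 1) ?mulr1.
    by rewrite mulmx_row_col (eq_bigr _ (fun i _ => expr2 _)).
  by rewrite -w1 mulmx_row_col; apply: eq_bigr => i _; rewrite expr2.
have Bs : B^T = B by rewrite /B linearB /= linearZ /= As Ps.
have trAP : \tr (A *m P) = mu by rewrite mxtrace_mulC trP.
have trPA : \tr (P *m A) = mu by rewrite trP.
have BB : \tr (B *m B) = \tr (A *m A) - mu ^+ 2.
  rewrite /B mulmxBl !mulmxBr -!scalemxAl -!scalemxAr PP !raddfB /= !mxtraceZ.
  rewrite trAP trPA trP1; ring.
have AAP : \tr (A *m A *m P) = \tr (P *m (A *m A)) by rewrite mxtrace_mulC.
have APA : \tr (A *m P *m A) = \tr (P *m (A *m A)).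
  by rewrite -mulmxA mxtrace_mulC mulmxA.
have APP : \tr (A *m P *m P) = mu by rewrite -mulmxA PP.
have PAP' : \tr (P *m A *m P) = mu by rewrite PAP mxtraceZ trP1 mulr1.
have BBB : \tr (B *m B *m B) =
    \tr (A *m A *m A) - 3 * mu * \tr (P *m (A *m A)) + 2 * mu ^+ 3.
  rewrite /B !(mulmxBl, mulmxBr) -!(scalemxAl, scalemxAr) PP !raddfB /= !mxtraceZ.
  rewrite AAP APA APP PAP' trPA PP trP1 -[P *m A *m A]mulmxA; ring.
have := mxtrace_cube_leq Bs; rewrite BB => cube.
have : (\tr (B *m B *m B)) ^+ 2 <= (b ^+ 3) ^+ 2.
  apply: le_trans cube _; rewrite exprAC lerXn2r ?nnegrE ?sqr_ge0 //.
  by rewrite -BB mxtrace_mul_sym // sumr_ge0 // => ij _; rewrite -expr2 sqr_ge0.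
have b3 : 0 <= b ^+ 3 by rewrite exprn_ge0.
have mu_nu : mu * mu ^+ 2 <= mu * \tr (P *m (A *m A)) by rewrite ler_wpM2l.
move=> /(sqr_lerN b3); rewrite BBB; move: mu_nu; rewrite -exprS.
by move: (\tr _) (\tr (A *m A *m A)) {nu BB AAP APA BBB cube} => x y; lra.
Qed.

End Trace.

(** * Traces and Rayleigh quotient of the adjacency matrix *)

Section Adjacency.
Local Open Scope complex_scope.
Set Implicit Arguments.
Unset Strict Implicit.
Variables (R : realType) (V : finType) (G : sgraph V).
Let A : 'M[R]_#|V| := adjmx R G.

Lemma adjmx_sym : A^T = A.
Proof. by apply/matrixP => i j; rewrite !mxE adj_sym. Qed.

Lemma sum_enum_val (F : V -> R) : \sum_(i < #|V|) F (enum_val i) = \sum_x F x.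
Proof. by rewrite -(big_enum_val F). Qed.

Lemma sum_setT (F : V -> R) : \sum_(x in [set: V]) F x = \sum_x F x.
Proof. by apply: eq_bigl => x; rewrite inE. Qed.

Lemma natr_arcs (S : {set V}) :
  (arcs G S)%:R = \sum_(x in S) \sum_(y in S) (G x y)%:R :> R.
Proof. by rewrite /arcs natr_sum; apply: eq_bigr => x _; rewrite natr_sum. Qed.

Lemma mxtrace_adjmx2 : \tr (A *m A) = (arcs G [set: V])%:R.
Proof.
rewrite natr_arcs sum_setT -sum_enum_val; apply: eq_bigr => i _.
rewrite mxE sum_setT -sum_enum_val; apply: eq_bigr => j _.
by rewrite !mxE [G (enum_val j) _]adj_sym -natrM mulnb andbb.
Qed.

Lemma mxtrace_adjmx3 : \tr (A *m A *m A) = (triples G [set: V])%:R.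
Proof.
rewrite /triples natr_sum sum_setT -sum_enum_val; apply: eq_bigr => i _.
rewrite natr_arcs mxE.
pose x := enum_val i.
transitivity (\sum_(y : V) (G x y)%:R * \sum_(z : V) (G x z)%:R * (G y z)%:R : R).
  rewrite -sum_enum_val; apply: eq_bigr => j _; rewrite mxE mulrC mxE adj_sym; congr (_ * _).
  by rewrite -sum_enum_val; apply: eq_bigr => l _; rewrite !mxE [G (enum_val l) _]adj_sym.
rewrite [RHS]big_mkcond; apply: eq_bigr => y _; rewrite !inE /=.
case: (G x y); rewrite ?mul0r // mul1r [RHS]big_mkcond; apply: eq_bigr => z _.
by rewrite !inE /=; case: (G x z); rewrite ?mul0r ?mul1r.
Qed.

Lemma lambda_rayleigh : (0 < #|V|)%N ->
  exists2 w : 'rV[R]_#|V|, (w *m w^T) 0 0 = 1 & lambda R G <= (w *m A *m w^T) 0 0.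
Proof.
move=> V0; rewrite /lambda.
have [z /eigenvalueP [v vA v0] <-] := spectral_radius_attained (adjmx R[i] G) V0.
pose x : 'rV[R]_#|V| := \row_i Normc.normc (v 0 i).
have x_ge0 i : 0 <= x 0 i by rewrite mxE; case: (v 0 i) => a b; apply: sqrtr_ge0.
pose N : R := \sum_i x 0 i ^+ 2.
have N0 : 0 < N.
  have [i vi] : exists i, v 0 i != 0 by apply/rV0Pn.
  rewrite /N (bigD1 i) //= ltr_pwDl ?sumr_ge0 // => [|j _]; last exact: sqr_ge0.
  rewrite exprn_gt0 // lt_neqAle x_ge0 andbT eq_sym mxE.
  by apply: contra vi => /eqP /Normc.eq0_normc ->.
have normc_sum (I : finType) (F : I -> R[i]) :
    Normc.normc (\sum_i F i) <= \sum_i Normc.normc (F i).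
  elim/big_ind2: _ => // [|x1 x2 y1 y2 h1 h2]; first by rewrite Normc.normc0.
  by apply: le_trans (le_normcD _ _) _; apply: lerD.
(* Moduli are taken in the eigenvalue equation; the entries of the matrix are 0 or 1, so the
   triangle inequality preserves them. *)
have xA i : Normc.normc z * x 0 i <= (x *m A) 0 i.
  move/matrixP/(_ 0 i): vA; rewrite !mxE => vA; rewrite -Normc.normcM -vA.
  apply: le_trans (normc_sum _ _) _; apply: ler_sum => j _; rewrite !mxE Normc.normcM.
  by case: (G _ _); rewrite ?Normc.normc0 ?Normc.normc1.
pose c : R := (Num.sqrt N)^-1.
have cN : c * c * N = 1.
  by rewrite /c -invfM -expr2 sqr_sqrtr ?ltW // mulVf // gt_eqF.
have c2 : 0 <= c * c by rewrite -expr2 sqr_ge0.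
exists (c *: x); rewrite linearZ /= -!(scalemxAl, scalemxAr) scalerA.
  rewrite [LHS]mxE mulmx_row_col -[RHS]cN; congr (_ * _).
rewrite [leRHS]mxE -[leLHS]mulr1 -cN mulrCA ler_wpM2l // mulmx_row_col mulr_sumr.
by apply: ler_sum => i _; rewrite expr2 mulrA ler_wpM2r.
Qed.

End Adjacency.

(** * Lower bound for the spectral radius of [Kplus] *)

Section KplusLambda.
Local Open Scope complex_scope.
Set Implicit Arguments.
Unset Strict Implicit.
Variable (R : realType).

(** Vectors constant on {0, 1}, on the rest of the larger part and on the smaller part stay so under
    the adjacency matrix; this is the 3 by 3 quotient. *)
Lemma sum_Kplus (n : nat) (j : 'I_n) (a b c : R) : (3 <= n)%N ->
  \sum_(i < n) (if i < 2 then a else if i < uphalf n then b else c)%N *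
    (Kplus n i j)%:R =
  if (j < 2)%N then a + n./2%:R * c
  else if (j < uphalf n)%N then n./2%:R * c
  else 2 * a + ((uphalf n)%:R - 2) * b.
Proof.
move=> n3; have [nE pk] := half_uphalf n.
set k := n./2 in nE pk *; set p := uphalf n in nE pk *.
pose F (i : nat) := (if i < 2 then a else if i < p then b else c)%N *
  (((i < p) != (j < p)) || [&& i != j, i < 2 & j < 2])%N%:R.
have lo : \sum_(0 <= i < 2) F i = F 0 + F 1 by rewrite big_nat_recl // big_nat1.
have mid x : (forall i, (2 <= i < p)%N -> F i = x) ->
    \sum_(2 <= i < p) F i = (p%:R - 2) * x.
  move=> Fx; rewrite (eq_big_nat _ _ Fx) sumr_const_nat -[LHS]mulr_natl natrB //.
  by lia.
have hi x : (forall i, (p <= i < n)%N -> F i = x) -> \sum_(p <= i < n) F i = k%:R * x.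
  move=> Fx; rewrite (eq_big_nat _ _ Fx) sumr_const_nat -[LHS]mulr_natl.
  by congr (_%:R * _); lia.
transitivity (\sum_(0 <= i < n) F i); first by rewrite big_mkord.
rewrite (big_cat_nat (n := 2)) /=; try lia.
rewrite (big_cat_nat (n := p) (m := 2)) /=; try lia.
have p0 : (0 < p)%N = true by lia.
have p1 : (1 < p)%N = true by lia.
have midE i : (2 <= i < p)%N -> (i < p)%N = true /\ (i < 2)%N = false by lia.
have hiE i : (p <= i < n)%N -> (i < p)%N = false /\ (i < 2)%N = false by lia.
rewrite lo; have [j2|j2] := ltnP j 2.
  have jp : (j < p)%N = true by lia.
  rewrite (mid 0) => [|i /midE [ip i2]]; last by rewrite /F jp ip i2 /= andbF mulr0.
  rewrite (hi c) => [|i /hiE [ip i2]]; last by rewrite /F jp ip i2 mulr1.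
  rewrite /F jp j2 p0 p1 /=; move: j2; clear.
  by case: (nat_of_ord j) => [|[|]] //= _; rewrite ?mulr0 ?mulr1 ?add0r ?addr0.
have j2F : (j < 2)%N = false by lia.
have [jp|jp] := ltnP j p.
  rewrite (mid 0) => [|i /midE [ip i2]]; last by rewrite /F jp ip i2 /= andbF mulr0.
  rewrite (hi c) => [|i /hiE [ip i2]]; last by rewrite /F jp ip i2 mulr1.
  by rewrite /F jp j2F p0 p1 /= !andbF !mulr0 !add0r.
have jpF : (j < p)%N = false by lia.
rewrite (mid b) => [|i /midE [ip i2]]; last by rewrite /F jpF ip i2 mulr1.
rewrite (hi 0) => [|i /hiE [ip i2]]; last by rewrite /F jpF ip i2 /= andbF mulr0.
by rewrite /F jpF p0 p1 /= !mulr1 mulr0 addr0 mulr_natl mulr2n.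
Qed.

(* The hypothesis on r is the characteristic equation of the quotient of the
   adjacency matrix by the classes {0, 1}, rest of the larger part, smaller part. *)
Lemma Kplus_eigenvalue (n : nat) (r : R) : (3 <= n)%N -> 1 < r ->
  (r ^+ 2 - (n./2 * uphalf n)%:R) * (r - 1) = 2 * n./2%:R ->
  r <= lambda R (Kplus n).
Proof.
move=> n3 r1 rE; set k : R := n./2%:R in rE *.
have k0 : 0 < k by rewrite ltr0n; have := half_uphalf n; lia.
(* These values solve the first two quotient equations identically; the third becomes the hypothesis
   on [r]. *)
pose c (i : 'I_n) : R := if (i < 2)%N then k * r else
  if (i < uphalf n)%N then k * (r - 1) else r * (r - 1).
have -> : r = Normc.normc r%:C.
  by rewrite /= expr0n addr0 sqrtr_sqr gtr0_norm //; lra.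
apply: spectral_radius_ge; apply/eigenvalueP.
exists (\row_i (c (enum_val i))%:C); last first.
  have n0 : (0 < n)%N by lia.
  apply/rV0Pn; exists (enum_rank (Ordinal n0)); rewrite mxE enum_rankK /c /=.
  by apply/eqP => /complexI; apply/eqP; rewrite mulf_neq0 ?gt_eqF //; lra.
apply/rowP => j; rewrite !mxE.
transitivity ((\sum_(i < n) c i * (Kplus n i (enum_val j))%:R)%:C).
  rewrite -(sum_enum_val (fun i => c i * (Kplus n i (enum_val j))%:R)) rmorph_sum.
  by apply: eq_bigr => i _; rewrite !mxE rmorphM rmorph_nat.
rewrite sum_Kplus // -rmorphM; congr (_%:C).
move: rE; rewrite natrM -/k /c; case: ifP => _; first by move=> _; ring.
by case: ifP => _ rE; [ring|nra].
Qed.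

Lemma lambda_Kplus_ge (n : nat) : (3 <= n)%N ->
  Num.sqrt (n./2 * uphalf n)%:R + (uphalf n)%:R^-1 <= lambda R (Kplus n).
Proof.
move=> n3; have [nE pk] := half_uphalf n.
set k := n./2 in nE pk *; set p := uphalf n in nE pk *.
set s : R := Num.sqrt _; set q : R := _^-1; set M : R := (k * p)%:R.
have s0 : 0 <= s := sqrtr_ge0 _.
have sM : s ^+ 2 = M by rewrite sqr_sqrtr // ler0n.
have p2 : 2 <= p%:R :> R by rewrite ler_nat; lia.
have k1 : 1 <= k%:R :> R by rewrite ler1n; lia.
have pq : p%:R * q = 1 by rewrite mulfV // gt_eqF //; lra.
have q0 : 0 < q by rewrite invr_gt0; lra.
have MkpR : M = k%:R * p%:R by rewrite /M natrM.
have kE : k%:R = s ^+ 2 * q by rewrite sM MkpR -mulrA pq mulr1.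
have q2 : q * 2 <= 1 by have : 0 <= (p%:R - 2) * q; [apply: mulr_ge0; lra|lra].
have s1 : 1 < s by nra.
pose P : {poly R} := ('X^2 - M%:P) * ('X - 1%:P) - (2 * k%:R)%:P.
have PE x : P.[x] = (x ^+ 2 - M) * (x - 1) - 2 * k%:R.
  by rewrite /P !hornerE.
pose b : R := M + 2 * k%:R + 2.
have sq_b : s + q <= b by rewrite /b; nra.
(* As k = s^2 q, the value at [s + q] is q(s(3q - 2) + q^2 - q), nonpositive because q <= 1/2; at
   the crude bound [b] the value is nonnegative. *)
have [|r /andP [sqr rb] /rootP rP] := poly_ivt (p := P) sq_b.
  rewrite !PE; apply/andP; split; first by rewrite -sM kE; nra.
  by rewrite /b; nra.
have r1 : 1 < r by lra.
apply: le_trans sqr _; apply: Kplus_eigenvalue => //.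
by move: rP; rewrite PE -/k -/p -/M; lra.
Qed.

End KplusLambda.

(** * Few edges: the spectral argument, and the conclusion *)

Lemma triangles_spectral (R : realType) (V : finType) (G : sgraph V) :
  let n := #|V| in (3 <= n)%N -> lambda R (Kplus n) <= lambda R G ->
  (arcs G [set: V] <= 2 * (n./2 * uphalf n))%N -> (n./2 < triangles G)%N.
Proof.
move=> n n3 hG aG; have [nE pk] := half_uphalf n.
have [|w w1 lw] := @lambda_rayleigh R V G; first by rewrite -/n; lia.
have mu_ge := le_trans (lambda_Kplus_ge R n3) (le_trans hG lw).
set k := n./2 in nE pk aG mu_ge *; set p := uphalf n in nE pk aG mu_ge *.
move: mu_ge; set s : R := Num.sqrt _; set q : R := _^-1.
set mu := (_ *m _ *m _) 0 0 => mu_ge.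
have s0 : 0 <= s := sqrtr_ge0 _.
have sM : s ^+ 2 = k%:R * p%:R by rewrite sqr_sqrtr ?ler0n // natrM.
have p2 : 2 <= p%:R :> R by rewrite ler_nat; lia.
have k1 : 1 <= k%:R :> R by rewrite ler1n; lia.
have pq : p%:R * q = 1 by rewrite mulfV // gt_eqF //; lra.
have q0 : 0 < q by rewrite invr_gt0; lra.
have kE : k%:R = s ^+ 2 * q by rewrite sM -mulrA pq mulr1.
have q1 : q <= 1 by have : 0 <= (p%:R - 2) * q; [apply: mulr_ge0; lra|lra].
have s1 : 1 <= s by rewrite leNgt; apply/negP; nra.
have aGR : (arcs G [set: V])%:R <= 2 * s ^+ 2.
  by rewrite sM -natrM -natrM ler_nat.
have mu_sqr : (s + q) ^+ 2 <= mu ^+ 2 by rewrite lerXn2r ?nnegrE; lra.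
have mu_cube : (s + q) ^+ 3 <= mu ^+ 3 by rewrite lerXn2r ?nnegrE; lra.
have := @mxtrace_cube_rayleigh R _ (adjmx R G) w (s - q) (adjmx_sym R G) w1.
rewrite -/mu mxtrace_adjmx2 mxtrace_adjmx3 triplesT natrM.
have -> : 0 <= mu by lra.
have -> : 0 <= s - q by lra.
(* Because (s + q)^2 + (s - q)^2 = 2s^2 + 2q^2 and [arcs] is at most 2s^2. *)
have -> : (arcs G [set: V])%:R - mu ^+ 2 <= (s - q) ^+ 2 by nra.
move=> /(_ isT isT isT) lower; rewrite -(ltr_nat R) kE.
have q3 : 0 < q ^+ 3 by rewrite exprn_gt0.
(* The term 2q^3 makes the final bound strict. *)
have cubes : (s + q) ^+ 3 - (s - q) ^+ 3 = 6 * (s ^+ 2 * q) + 2 * q ^+ 3 by ring.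
by lra.
Qed.

Theorem theorem2p2 (R : realType) (n : nat) (hn : (3 <= n)%N)
    (V : finType) (hV : #|V| = n) (G : sgraph V)
    (hG : lambda R G >= lambda R (Kplus n)) :
  (triangles G >= n./2)%N /\
  (triangles G = n./2 <-> isomorphic G (Kplus n)).
Proof.
have iso_le : isomorphic G (Kplus n) -> (triangles G <= n./2)%N.
  by move=> /triangles_isomorphic /leq_trans; apply; apply: triangles_Kplus.
(* With at most kp edges the bound is strict, so both sides of the equivalence fail. *)
have [aG|aG] := leqP (arcs G [set: V]) (2 * (n./2 * uphalf n)).
  have lt_t : (n./2 < triangles G)%N.
    by subst n; apply: (@triangles_spectral R) aG.
  split; first exact: ltnW.
  by split=> [tE|/iso_le]; [rewrite tE ltnn in lt_t | rewrite leqNgt lt_t].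
have ge_t : (n./2 <= triangles G)%N.
  have := @rademacher _ G [set: V]; rewrite cardsT hV => /(_ aG).
  by rewrite triplesT leq_pmul2l.
split=> //; split=> [tE|/iso_le le_t]; last by apply/eqP; rewrite eqn_leq le_t.
have [|||X [a [b [Xp KX]]]] := @rademacher_eq _ G; rewrite ?hV //.
  by rewrite triplesT tE.
by apply: Kplus_on_isomorphic KX; rewrite ?Xp ?hV.
Qed.
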